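(* Let $L$ be a compactly generated multiplicative lattice in which the top element $1$ is compact and every finite product of compact elements is compact. The following statements are equivalent. (1) $L$ is a $pz$-multiplicative lattice, i.e. every prime element of $L$ is a $z$-element. (2) Every semiprime element of $L$ is a $z$-element. (3) $\mathsf{m}_a=\bigwedge\{p\mid p \text{ is a prime element of } L,\ a\leqslant p\}$ for all $a\in L$. (4) $\mathrm{c}\ell(a)=\sqrt{a}$ for all $a\in L$.
   Context: A multiplicative lattice is a complete lattice $(L,\leqslant,0,1)$ endowed with an associative, commutative multiplication which distributes over arbitrary joins and has $1$ as multiplicative identity. An element $c\in L$ is compact if for any $\{x_\lambda\}_{\lambda\in\Lambda}\subseteq L$, $c\leqslant\bigvee_{\lambda\in\Lambda}x_\lambda$ implies $c\leqslant\bigvee_{i=1}^n x_{\lambda_i}$ for some $n\in\mathbb{N}^+$ and $\lambda_1,\dots,\lambda_n\in\Lambda$; $L$ is compactly generated if every element of $L$ is a join of compact elements. An element $x$ is proper if $x\neq 1$. A proper element $m$ is maximal if $m\leqslant x$ and $x<1$ imply $m=x$, for all $x\in L$; $\mathcal{M}(L)$ is the set of maximal elements. A proper element $p$ is prime if $xy\leqslant p$ implies $x\leqslant p$ or $y\leqslant p$, for all $x,y\in L$. A proper element $q$ is semiprime if $a^2\leqslant q$ implies $a\leqslant q$, for all $a\in L$. For $a\in L$ put $\mathcal{M}_a=\{m\in\mathcal{M}(L)\mid a\leqslant m\}$ and $\mathsf{m}_a=\bigwedge\mathcal{M}_a$ (empty meets are $1$). An element $x\in L$ is a $z$-element if for all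 $a,b\in L$, $\mathcal{M}_a=\mathcal{M}_b$ and $b\leqslant x$ imply $a\leqslant x$; $\mathcal{Z}(L)$ is the set of $z$-elements. The $z$-closure operator is $\mathrm{c}\ell(a)=\bigwedge\{z\in\mathcal{Z}(L)\mid a\leqslant z\}$. The radical of $x\in L$ is $\sqrt{x}=\bigvee\{y\in L\mid y \text{ compact},\ y^n\leqslant x \text{ for some } n\in\mathbb{N}^+\}=\bigwedge\{p \mid p\text{ prime},\ x\leqslant p\}$. *)

(* Defs.v *)
From HB Require Import structures.
From mathcomp Require Import all_boot all_order.
From mathcomp Require Import boolp classical_sets.

Set Implicit Arguments.
Unset Strict Implicit.
Unset Printing Implicit Defensive.

Import Order.TTheory.

Local Open Scope classical_set_scope.
Local Open Scope group_scope.
Local Open Scope order_scope.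

HB.mixin Record TBLattice_isComplete (d : Order.disp_t) L
    of Order.TBLattice d L := {
  supremums_neq0 : forall A : set L, supremums A !=set0;
  infimums_neq0 : forall A : set L, infimums A !=set0
}.

#[short(type="completeLatticeType")]
HB.structure Definition CompleteLattice (d : Order.disp_t) :=
  { L of TBLattice_isComplete d L & Order.TBLattice d L }.

(* The defaults of [supremum] and [infimum] are their values on the empty set:
   the empty join is 0 and the empty meet is 1. *)
Definition lub (d : Order.disp_t) (L : completeLatticeType d) (A : set L) : L :=
  supremum \bot A.

Definition glb (d : Order.disp_t) (L : completeLatticeType d) (A : set L) : L :=
  infimum \top A.

HB.mixin Record CompleteLattice_isMultiplicative (d : Order.disp_t) L
    of CompleteLattice d L & Monoid L := {
  mulgC : forall x y : L, x * y = y * x;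
  one_top : 1 = \top :> L;
  mulg_lub : forall (x : L) (A : set L), x * lub A = lub [set x * a | a in A]
}.

#[short(type="multLatticeType")]
HB.structure Definition MultLattice (d : Order.disp_t) :=
  { L of CompleteLattice_isMultiplicative d L & CompleteLattice d L
       & Monoid L }.

Section MultiplicativeLattice.
Context {d : Order.disp_t} {L : multLatticeType d}.
Implicit Types (a c m p q x y z : L) (A : set L).

(* As the finite subfamily is nonempty, so must be the family that is covered:
   with the empty family allowed, 0 would never be compact. *)
Definition compact_element c : Prop :=
  forall A, A !=set0 -> c <= lub A ->
  exists s : seq L,
    [/\ s != [::], forall x, x \in s -> A x & c <= \join_(x <- s) x].

Definition proper_element x : Prop := x <> \top.

Definition maximal_element m : Prop :=
  proper_element m /\ forall x, m <= x -> x < \top -> m = x.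

Definition prime_element p : Prop :=
  proper_element p /\ forall x y, x * y <= p -> x <= p \/ y <= p.

Definition semiprime_element q : Prop :=
  proper_element q /\ forall a, a ^+ 2 <= q -> a <= q.

Definition maximals_above a : set L := [set m | maximal_element m /\ a <= m].

Definition meet_maximals a : L := glb (maximals_above a).

Definition z_element x : Prop :=
  forall a b : L, maximals_above a = maximals_above b -> b <= x -> a <= x.

Definition z_closure a : L := glb [set z | z_element z /\ a <= z].

Definition radical x : L :=
  lub [set y | compact_element y /\ exists n : nat, (0 < n)%N /\ y ^+ n <= x].

End MultiplicativeLattice.

Definition compactly_generated (d : Order.disp_t) (L : multLatticeType d) : Prop :=
  forall x : L, exists A : set L,
    (forall c, A c -> compact_element c) /\ x = lub A.

Definition pz_lattice (d : Order.disp_t) (L : multLatticeType d) : Prop :=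
  forall p : L, prime_element p -> z_element p.

(* Main.v *)
(**
  The z-closure of [a] is always [meet_maximals a]: this element is a z-element,
  and it lies over the same maximal elements as [a], hence below every z-element
  above [a]. Conditions (3) and (4) therefore differ only by Krull's theorem, that
  the radical of [a] is the meet of the primes above [a]; this is Zorn's lemma
  applied to the elements above [a] containing no power of a given compact
  element. Semiprime elements are equal to their radical, so they are meets of
  primes, and z-elements are closed under meets.
*)
Require Import Defs.
From HB Require Import structures.
From mathcomp Require Import all_boot all_order.
From mathcomp Require Import boolp classical_sets.

Import Order.TTheory.

Local Open Scope classical_set_scope.
Local Open Scope group_scope.
Local Open Scope order_scope.

Section CompleteLattice.
Context {d : Order.disp_t} {L : completeLatticeType d}.
Implicit Types (x : L) (A : set L).

Lemma lub_supremums A : supremums A (lub A).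
Proof.
rewrite /lub /supremum; case: ifPn => [/eqP ->|_]; first by split.
by case: xgetP => [y _ //|nA]; have [y /nA] := supremums_neq0 A.
Qed.

Lemma glb_infimums A : infimums A (glb A).
Proof.
rewrite /glb /infimum; case: ifPn => [/eqP ->|_].
  by split=> // x _; exact: lex1.
by case: xgetP => [y _ //|nA]; have [y /nA] := infimums_neq0 A.
Qed.

Lemma lub_ub A x : A x -> x <= lub A.
Proof. by case: (lub_supremums A) => + _; apply. Qed.

Lemma lub_le A x : (forall y, A y -> y <= x) -> lub A <= x.
Proof. by case: (lub_supremums A) => _; apply. Qed.

Lemma glb_lb A x : A x -> glb A <= x.
Proof. by case: (glb_infimums A) => + _; apply. Qed.

Lemma le_glb A x : (forall y, A y -> x <= y) -> x <= glb A.
Proof. by case: (glb_infimums A) => _; apply. Qed.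

Lemma lub_set2 (x y : L) : lub [set x; y] = x `|` y.
Proof.
apply/le_anti/andP; split.
  by apply: lub_le => z [] ->; [exact: leUl | exact: leUr].
by rewrite leUx; apply/andP; split; apply: lub_ub; [left | right].
Qed.

End CompleteLattice.

Section MultiplicativeLattice.
Context {d : Order.disp_t} {L : multLatticeType d}.
Implicit Types (a c m p q x y z : L) (n k : nat).

Lemma mulg_joinr x y z : x * (y `|` z) = (x * y) `|` (x * z).
Proof. by rewrite -!lub_set2 mulg_lub image_setU !image_set1. Qed.

Lemma leM2l x y z : y <= z -> x * y <= x * z.
Proof. by move=> /join_r <-; rewrite mulg_joinr leUl. Qed.

Lemma leM x y z t : x <= y -> z <= t -> x * z <= y * t.
Proof.
move=> xy zt; apply: le_trans (leM2l _ _ _ zt) _.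
by rewrite !(mulgC _ t) leM2l.
Qed.

Lemma leMl x y : x * y <= x.
Proof. by rewrite -[leRHS]mulg1 leM2l// one_top lex1. Qed.

Lemma leMr x y : x * y <= y.
Proof. by rewrite mulgC leMl. Qed.

Lemma leX_exp x n k : (k <= n)%N -> x ^+ n <= x ^+ k.
Proof. by move=> /subnK <-; rewrite expgnDr leMr. Qed.

(** Once the product is expanded, every term other than [x * y] has a factor [p]. Both primality
    arguments below rest on this inequality. *)
Lemma join_mul_le p x y : x * y <= p -> (p `|` x) * (p `|` y) <= p.
Proof.
move=> xyp; rewrite mulg_joinr leUx leMr /=.
by rewrite mulgC mulg_joinr leUx leMr /= mulgC.
Qed.

(** If neither factor lies below [m], both joins with [m] are the top element by maximality, and
    [join_mul_le] then gives [1 * 1 <= m], against properness. *)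
Lemma maximal_prime m : maximal_element m -> prime_element m.
Proof.
move=> [m_proper m_max]; split=> // x y xym.
have join_top z : ~~ (z <= m) -> m `|` z = \top.
  move=> zm; apply/eqP; apply: contraNT zm => ntop.
  by rewrite (m_max (m `|` z)) ?leUr ?leUl// lt_neqAle ntop lex1.
have [xm|/join_top xtop] := boolP (x <= m); first by left.
have [ym|/join_top ytop] := boolP (y <= m); first by right.
have := join_mul_le m x y xym.
rewrite xtop ytop -one_top mulg1 one_top => top_le.
by case: m_proper; apply/le_anti; rewrite lex1.
Qed.

Lemma prime_semiprime p : prime_element p -> semiprime_element p.
Proof. by move=> [p1 pM]; split=> // a /pM[]. Qed.

Lemma semiprime_expg q x n :
  semiprime_element q -> (0 < n)%N -> x ^+ n <= q -> x <= q.
Proof.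
move=> [_ q2]; elim: n => // -[|n] IHn _; first by rewrite expg1.
move=> xq; apply: IHn => //; apply: q2.
(* The square of [x ^+ n.+1] has exponent at least [n.+2], and higher powers are smaller, so the
   exponent drops by one at each step. *)
rewrite -expgnA; apply: le_trans xq; apply: leX_exp.
by rewrite muln2 -addnn addSn addnS !ltnS leq_addl.
Qed.

(** Compactness leaves finitely many members of the chain, and the largest of them bounds their
    join. *)
Lemma compact_lub_chain c (A : set L) :
  compact_element c -> A !=set0 -> total_on A (fun x y => x <= y) ->
  c <= lub A -> exists2 x, A x & c <= x.
Proof.
move=> c_compact A0 A_tot /(c_compact A A0)[s [s0 sA cs]].
suff [x Ax sx] : exists2 x, A x & \join_(y <- s) y <= x.
  by exists x => //; exact: le_trans sx.
elim: s s0 sA {cs} => // y [|z s] IHs _ sA.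
  by exists y; rewrite ?big_seq1//; apply: sA; rewrite mem_head.
have [//|t ys|x Ax sx] := IHs; first by apply: sA; rewrite inE ys orbT.
have Ay : A y by apply: sA; rewrite mem_head.
rewrite big_cons; case: (A_tot x y Ax Ay) => xy.
  by exists y => //; rewrite leUx lexx (le_trans sx).
by exists x => //; rewrite leUx xy.
Qed.

(** An element that is maximal among those above [a] and above no positive power of [c] is prime.
    Compactness of the powers lets Zorn's lemma apply: a power of [c] below the join of a chain is
    below a member. *)
Lemma exists_prime a c :
  (forall n, compact_element (c ^+ n)) ->
  (forall n, (0 < n)%N -> ~~ (c ^+ n <= a)) ->
  exists p, [/\ prime_element p, a <= p & ~~ (c <= p)].
Proof.
move=> cX_compact ca.
pose S x := a <= x /\ forall n, (0 < n)%N -> ~~ (c ^+ n <= x).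
have Sa : S a by [].
have [||||[p [ap cp]] /= p_max] :=
    @Zorn {x : L | S x} (fun u v => sval u <= sval v).
- by move=> ?.
- by move=> u v w; exact: le_trans.
- by move=> [x Sx] [y Sy] /= xy yx; apply: eq_exist; apply/le_anti/andP.
- move=> A A_tot.
  (* The empty chain needs [a] as its bound, since the empty join is the bottom element and may fail
     to lie above [a]. *)
  have [->|/set0P A0] := eqVneq A set0; first by exists (exist S a Sa).
  pose B := [set sval u | u in A].
  have B0 : B !=set0 by have [u Au] := A0; exists (sval u), u.
  have B_tot : total_on B (fun x y => x <= y).
    by move=> _ _ [u Au <-] [v Av <-]; exact: A_tot.
  have SB : S (lub B).
    split=> [|n n0].
      have [u Au] := A0; apply: (le_trans (svalP u).1).
      by apply: lub_ub; exists u.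
    apply/negP => /(compact_lub_chain _ _ (cX_compact n) B0 B_tot).
    by move=> [_ [u Au <-]]; apply/negP; exact: (svalP u).2.
  by exists (exist S (lub B) SB) => u Au; apply: lub_ub; exists u.
exists p; split=> //; last by rewrite -(expg1 c) cp.
split=> [ptop|x y xyp].
  by have := cp 1%N erefl; rewrite ptop lex1.
(* By maximality of [p], a strictly larger join must lie above some positive power of [c]. *)
have powers z : ~~ (z <= p) -> exists2 n, (0 < n)%N & c ^+ n <= p `|` z.
  move=> zp; apply: contrapT => noexp.
  have Spz : S (p `|` z).
    split=> [|n n0]; first by rewrite (le_trans ap) ?leUl.
    by apply/negP => cn; apply: noexp; exists n.
  have /= := p_max (exist S (p `|` z) Spz) (leUl _ _).
  by case=> pz; move: zp; rewrite -pz leUr.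
have [xp|/powers[n n0 cn]] := boolP (x <= p); first by left.
have [yp|/powers[k k0 ck]] := boolP (y <= p); first by right.
(* Multiplying the two powers puts [c ^+ (n + k)] below the product of the joins, hence below
   [p]. *)
have /negP[] := cp (n + k)%N (ltn_addr _ n0).
by rewrite expgnDr (le_trans (leM _ _ _ _ cn ck))// join_mul_le.
Qed.

Lemma maximals_above_meet a :
  maximals_above (meet_maximals a) = maximals_above a.
Proof.
apply/seteqP; split=> m [m_max am]; split=> //.
  by apply: le_trans am; apply: le_glb => ? [].
exact: glb_lb.
Qed.

Lemma le_meet_maximals a : a <= meet_maximals a.
Proof. by apply: le_glb => m []. Qed.

Lemma z_element_glb (A : set L) :
  (forall z, A z -> z_element z) -> z_element (glb A).
Proof.
move=> Az a b ab bA; apply: le_glb => z zA; apply: (Az z zA a b ab).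
by rewrite (le_trans bA) ?glb_lb.
Qed.

Lemma meet_maximals_le a z : z_element z -> a <= z -> meet_maximals a <= z.
Proof. by move=> zz; apply: zz; exact: maximals_above_meet. Qed.

(** Each maximal [m] is a z-element, because [c <= m] says precisely that [m] belongs to
    [maximals_above c]. *)
Lemma z_element_meet_maximals a : z_element (meet_maximals a).
Proof.
apply: z_element_glb => m [m_max _] b c bc cm.
have : maximals_above c m by [].
by rewrite -bc => -[].
Qed.

Lemma z_closure_meet_maximals a : z_closure a = meet_maximals a.
Proof.
apply/le_anti/andP; split.
  by apply: glb_lb; split; [exact: z_element_meet_maximals
                           | exact: le_meet_maximals].
by apply: le_glb => z [zz az]; exact: meet_maximals_le.
Qed.

Lemma radical_le_semiprime a q : semiprime_element q -> a <= q -> radical a <= q.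
Proof.
move=> q2 aq; apply: lub_le => y [_ [n [n0 ya]]].
by apply: (semiprime_expg _ _ _ q2 n0); exact: le_trans aq.
Qed.

End MultiplicativeLattice.

Section CompactlyGenerated.
Context {d : Order.disp_t} {L : multLatticeType d}.
Context (L_cg : compactly_generated L).
Context (prod_compact : forall s : seq L,
  (forall x : L, x \in s -> compact_element x) ->
  compact_element (\prod_(x <- s) x)).

Lemma compact_expg (c : L) (n : nat) :
  compact_element c -> compact_element (c ^+ n).
Proof.
move=> c_compact; rewrite -iter_mulg_1 -(big_nseq _ _ n c id).
by apply: prod_compact => x /nseqP[->].
Qed.

Lemma le_compact (x y : L) :
  (forall c, compact_element c -> c <= x -> c <= y) -> x <= y.
Proof.
have [A [A_compact ->]] := L_cg x => le_y.
by apply: lub_le => c Ac; apply: le_y; [exact: A_compact | exact: lub_ub].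
Qed.

Lemma radical_primes (a : L) :
  radical a = glb [set p : L | prime_element p /\ a <= p].
Proof.
apply/le_anti/andP; split.
  by apply: le_glb => p [/prime_semiprime p2 ap]; exact: radical_le_semiprime.
apply: le_compact => c c_compact c_primes; apply: lub_ub; split=> //.
(* If no positive power of [c] is below [a], some prime above [a] is not above [c], contradicting
   [c_primes]. *)
apply: contrapT => noexp.
have [|n n0|p [p_prime ap /negP[]]] := exists_prime a c.
- by move=> n; exact: compact_expg.
- by apply/negP => ca; apply: noexp; exists n.
- by rewrite (le_trans c_primes) ?glb_lb.
Qed.

Lemma le_radical (a : L) : a <= radical a.
Proof. by rewrite radical_primes; apply: le_glb => p []. Qed.

Lemma radical_semiprime (q : L) : semiprime_element q -> radical q = q.
Proof.
by move=> q2; apply/le_anti; rewrite le_radical radical_le_semiprime.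
Qed.

End CompactlyGenerated.

Theorem proposition4p7 (d : Order.disp_t) (L : multLatticeType d)
    (L_cg : compactly_generated L)
    (top_compact : compact_element (\top : L))
    (prod_compact : forall s : seq L,
      (forall x : L, x \in s -> compact_element x) ->
      compact_element (\prod_(x <- s) x)) :
  [<-> pz_lattice L;
       forall q : L, semiprime_element q -> z_element q;
       forall a : L, meet_maximals a = glb [set p : L | prime_element p /\ a <= p];
       forall a : L, z_closure a = radical a].
Proof.
have radE := radical_primes L_cg prod_compact.
have semiE := radical_semiprime L_cg prod_compact.
(* The implications are proved in a cycle; in the first, [q] is replaced by its radical, a meet of
   primes. *)
tfae=> [pz q /semiE<-|sz a|mE a|clE p p_prime].
- by rewrite radE; apply: z_element_glb => p [/pz].
- apply/le_anti/andP; split.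
    by apply: le_glb => p [/prime_semiprime/sz pz ap]; exact: meet_maximals_le.
  by apply: le_glb => m [m_max am]; apply: glb_lb; split=> //;
    exact: maximal_prime.
- by rewrite z_closure_meet_maximals mE radE.
(* The prime [p] is its own radical, hence by (4) its own z-closure, which is a z-element. *)
- rewrite -(semiE p (prime_semiprime _ p_prime)) -clE z_closure_meet_maximals.
  exact: z_element_meet_maximals.
Qed.
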